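(* A finite-dimensional complex Lie algebra $\mathcal{L}$ is Jacobson-free if and only if $\mathcal{L}$ is the direct sum of a semisimple and a commutative Lie algebra (either of which may be zero).
   Context: A finite-dimensional Lie algebra $\mathcal{L}$ is Jacobson-free if the intersection of all its maximal proper Lie ideals is $\{0\}$ (the intersection over the empty family being $\mathcal{L}$). A finite-dimensional Lie algebra is semisimple if it has no non-zero commutative Lie ideals. *)

(* Defs.v *)
From HB Require Import structures.
From mathcomp Require Import all_boot all_algebra.
From mathcomp Require Import classical_sets reals complex.

Set Implicit Arguments.
Unset Strict Implicit.
Unset Printing Implicit Defensive.

Import GRing.Theory.
Local Open Scope ring_scope.

(* Finite-dimensionality comes from the vectType structure. *)
HB.mixin Record Vector_isLieAlgebra (K : fieldType) L of Vector K L := {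
  lie : L -> L -> L;
  lie_linearl : forall y : L, linear (fun x => lie x y);
  lie_linearr : forall x : L, linear (lie x);
  liexx : forall x : L, lie x x = 0;
  lie_jacobi : forall x y z : L,
    lie x (lie y z) + lie y (lie z x) + lie z (lie x y) = 0
}.

#[short(type="lieAlgType")]
HB.structure Definition LieAlgebra (K : fieldType) :=
  { L of Vector_isLieAlgebra K L & Vector K L }.

Section DirectSum.
Variables (K : fieldType) (S A : lieAlgType K).

Definition prod_lie (u v : S * A) : S * A := (lie u.1 v.1, lie u.2 v.2).

Lemma prod_lie_linearl (v : S * A) : linear (fun u => prod_lie u v).
Proof.
move=> a u w; rewrite /prod_lie /=.
by rewrite [lie (a *: u.1 + _) _]lie_linearl [lie (a *: u.2 + _) _]lie_linearl.
Qed.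

Lemma prod_lie_linearr (u : S * A) : linear (prod_lie u).
Proof. by move=> a v w; rewrite /prod_lie /= !lie_linearr. Qed.

Lemma prod_liexx (u : S * A) : prod_lie u u = 0.
Proof. by rewrite /prod_lie !liexx. Qed.

Lemma prod_lie_jacobi (u v w : S * A) :
  prod_lie u (prod_lie v w) + prod_lie v (prod_lie w u)
    + prod_lie w (prod_lie u v) = 0.
Proof.
by apply/eqP; rewrite /prod_lie; apply/andP; split; apply/eqP => /=;
  exact: lie_jacobi.
Qed.

HB.instance Definition _ := Vector_isLieAlgebra.Build K (S * A)%type
  prod_lie_linearl prod_lie_linearr prod_liexx prod_lie_jacobi.

End DirectSum.

Section LieTheory.
Variables (K : fieldType) (L : lieAlgType K).

(* One-sided closure suffices, the bracket being antisymmetric. *)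
Definition lie_ideal (I : {vspace L}) : Prop :=
  forall x y : L, y \in I -> lie x y \in I.

Definition maximal_lie_ideal (I : {vspace L}) : Prop :=
  [/\ lie_ideal I, I <> fullv &
      forall J : {vspace L}, lie_ideal J -> (I <= J)%VS -> J = I \/ J = fullv].

(* With no maximal proper ideal (i.e. [L = 0]) the intersection is [setT]. *)
Definition jacobson_free : Prop :=
  (\bigcap_(I in [set I | maximal_lie_ideal I]) [set x : L | x \in I]
    = [set 0])%classic.

Definition lie_commutative : Prop := forall x y : L, lie x y = 0.

Definition commutative_ideal (I : {vspace L}) : Prop :=
  lie_ideal I /\ (forall x y : L, x \in I -> y \in I -> lie x y = 0).

Definition lie_semisimple : Prop :=
  forall I : {vspace L}, commutative_ideal I -> I = 0%VS.

End LieTheory.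

Arguments jacobson_free {K} L.
Arguments lie_commutative {K} L.
Arguments lie_semisimple {K} L.

Definition lie_isomorphic (K : fieldType) (L M : lieAlgType K) : Prop :=
  exists f : {linear L -> M},
    bijective f /\ (forall x y : L, f (lie x y) = lie (f x) (f y)).

(* Main.v *)
(* Jacobson-free means that every ideal has a complementary ideal: the
   complement [J] of [I] is a minimal ideal with [I + J = L], a maximal ideal
   missing [I :&: J] contradicting minimality otherwise.  So a Jacobson-free
   [L] is its center plus an ideal [S], and a commutative ideal of [S] is
   central (it commutes with itself and with its complement), hence zero.
   Conversely the Jacobson radical of a product projects into those of the
   factors, and a semisimple algebra is Jacobson-free since a minimal ideal [I]
   is complemented by its orthogonal [I^perp] for the Killing form: otherwise
   [I <= I^perp] and [I = [I, I]], so that [ad x] is nilpotent for [x] in [I] by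
   Cartan's argument, against Engel's theorem. *)
Require Import Defs.
From HB Require Import structures.
From mathcomp Require Import all_boot all_order all_algebra.
From mathcomp Require Import boolp classical_sets reals complex.
From mathcomp Require Import ring zify.

Set Implicit Arguments.
Unset Strict Implicit.
Unset Printing Implicit Defensive.

Import Order.TTheory GRing.Theory Num.Theory VectorInternalTheory.
Local Open Scope ring_scope.

(** * Matrices with conjugate eigenvalues *)

Lemma coprimep_prod_XsubC_exp (F : fieldType) (c : F) (s : seq F)
    (e : F -> nat) M : c \notin s ->
  coprimep (('X - c%:P) ^+ M) (\prod_(d <- s) ('X - d%:P) ^+ e d).
Proof.
elim: s => [|d s IHs]; first by rewrite big_nil coprimep1.
rewrite inE negb_or big_cons coprimepMr => /andP[cd /IHs ->]; rewrite andbT.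
apply/coprimep_expl/coprimep_expr.
by rewrite coprimep_XsubC root_XsubC eq_sym.
Qed.

(** Chinese remaindering: powers of distinct linear factors are coprime, and the points are treated
    one at a time. *)
Lemma poly_interp (F : fieldType) (f : F -> F) (s : seq F) (M : nat) :
  uniq s -> exists p : {poly F},
    forall c, c \in s -> ('X - c%:P) ^+ M %| p - (f c)%:P.
Proof.
elim: s => [|c s IHs] /=; first by exists 0.
case/andP=> cNs /IHs[p pP].
have := coprimep_prod_XsubC_exp (fun=> M) M cNs.
set q := \prod_(d <- s) _ => /Bezout_eq1_coprimepP[[u v] /= uv].
(* [v * q] is 1 modulo the power at [c] and 0 modulo the powers at points of [s], so the correction
   fixes the value at [c] and spoils no other. *)
exists (p + v * q * ((f c)%:P - p)) => d; rewrite inE => /orP[/eqP-> | ds].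
  have -> : p + v * q * ((f c)%:P - p) - (f c)%:P
         = u * ('X - c%:P) ^+ M * (p - (f c)%:P).
    have -> : v * q = 1 - u * ('X - c%:P) ^+ M by rewrite -uv addrC addKr.
    by rewrite mulrBl mul1r -[(f c)%:P - p]opprB mulrN; ring.
  by rewrite mulrAC dvdp_mull.
rewrite addrAC dvdp_add ?pP // dvdp_mulr // dvdp_mull // /q (big_rem d) //=.
by rewrite dvdp_mulr.
Qed.

Section HornerMx.
Variables (F : fieldType) (n : nat) (D : 'M[F]_n.+1).

Lemma horner_mx_stable_gen m (V : 'M[F]_(m, n.+1)) p :
  stablemx V D -> stablemx V (horner_mx D p).
Proof.
move=> VD; elim/poly_ind: p => [|p c IHp]; first by rewrite rmorph0 stablemx0.
rewrite rmorphD rmorphM /= horner_mx_X horner_mx_C.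
by rewrite stablemxD ?stablemxM ?stablemxC.
Qed.

Lemma horner_mx_XsubC_exp c k :
  horner_mx D (('X - c%:P) ^+ k) = (D - c%:M) ^+ k.
Proof. by rewrite rmorphXn rmorphB /= horner_mx_X horner_mx_C. Qed.

Lemma horner_mx_gen_eigen (v : 'rV_n.+1) c z p k M : (k <= M)%N ->
  v *m (D - c%:M) ^+ k = 0 -> ('X - c%:P) ^+ M %| p - z%:P ->
  v *m horner_mx D p = z *: v.
Proof.
move=> kM vk /(dvdp_trans (dvdp_exp2l _ kM)) /dvdpP[g pE].
have -> : p = ('X - c%:P) ^+ k * g + z%:P by rewrite mulrC -pE subrK.
rewrite rmorphD rmorphM /= horner_mx_C horner_mx_XsubC_exp.
by rewrite mulmxDr mulmxA vk mul0mx add0r mul_mx_scalar.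
Qed.

(** Primary decomposition as an induction principle: Bezout splits a vector killed by the product
    into generalized eigenvectors, so an additive property need only be checked on these. *)
Lemma gen_eigen_ind (P : 'rV[F]_n.+1 -> Prop) (e : F -> nat) (s : seq F) :
    P 0 -> (forall u v, P u -> P v -> P (u + v)) ->
    (forall c v, c \in s -> v *m (D - c%:M) ^+ e c = 0 -> P v) ->
    uniq s ->
  forall v, v *m horner_mx D (\prod_(c <- s) ('X - c%:P) ^+ e c) = 0 -> P v.
Proof.
move=> P0 PD; elim: s => [|c s IHs] Ps.
  by move=> _ v; rewrite big_nil rmorph1 mulmx1 => ->.
case/andP=> cNs us v; rewrite big_cons.
have := coprimep_prod_XsubC_exp e (e c) cNs.
set q := \prod_(d <- s) _ => /Bezout_eq1_coprimepP[[a b] /= ab] vq.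
(* The first summand is killed by [q] evaluated at [D], the second by the power of [D - c%:M]. *)
have -> : v = v *m horner_mx D (a * ('X - c%:P) ^+ e c)
            + v *m horner_mx D (b * q).
  by rewrite -mulmxDr -rmorphD /= ab rmorph1 mulmx1.
apply: PD.
  apply: IHs => // [d u ds|]; first by apply: Ps; rewrite inE ds orbT.
  rewrite -mulmxA mulmxE -rmorphM -mulrA mulrC rmorphM /= -mulmxE.
  by rewrite mulmxA vq mul0mx.
apply: (Ps c); first exact: mem_head.
rewrite -horner_mx_XsubC_exp -mulmxA mulmxE -rmorphM.
have -> : b * q * ('X - c%:P) ^+ e c = ('X - c%:P) ^+ e c * q * b by ring.
by rewrite rmorphM /= -mulmxE mulmxA vq mul0mx.
Qed.

End HornerMx.

(** * Derivations of a bilinear product *)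

Section Derivation.
Variables (F : fieldType) (n : nat) (B : 'rV[F]_n -> 'rV[F]_n -> 'rV[F]_n).
Hypothesis Bl : forall b, linear (B^~ b).
Hypothesis Br : forall a, linear (B a).

Definition mx_derivation (D : 'M[F]_n) :=
  forall a b, B a b *m D = B (a *m D) b + B a (b *m D).

Let B0l b : B 0 b = 0.
Proof. by have := Bl b (-1) 0 0; rewrite scaler0 addr0 scaleN1r addNr. Qed.
Let B0r a : B a 0 = 0.
Proof. by have := Br a (-1) 0 0; rewrite scaler0 addr0 scaleN1r addNr. Qed.
Let BDl a a' b : B (a + a') b = B a b + B a' b.
Proof. by have := Bl b 1 a a'; rewrite !scale1r. Qed.
Let BDr a b b' : B a (b + b') = B a b + B a b'.
Proof. by have := Br a 1 b b'; rewrite !scale1r. Qed.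
Let BZl z a b : B (z *: a) b = z *: B a b.
Proof. by have := Bl b z a 0; rewrite !addr0 B0l addr0. Qed.
Let BZr z a b : B a (z *: b) = z *: B a b.
Proof. by have := Br a z b 0; rewrite !addr0 B0r addr0. Qed.

(** By the Leibniz rule, [D - (c + d)] applied to [B a b] applies [D - c] to [a] or [D - d] to [b];
    induction on [j + k], one exponent dropping in each term. *)
Lemma derivation_gen_eigen (D : 'M[F]_n) c d j k a b : mx_derivation D ->
  a *m (D - c%:M) ^+ j = 0 -> b *m (D - d%:M) ^+ k = 0 ->
  B a b *m (D - (c + d)%:M) ^+ (j + k) = 0.
Proof.
move=> der; move jk: (j + k)%N => m.
elim: m j k jk a b => [|m IHm] [|j] k jk a b.
- by rewrite expr0 mulmx1 => -> _; rewrite B0l mul0mx.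
- by [].
- by rewrite expr0 mulmx1 => -> _; rewrite B0l mul0mx.
case: k jk => [|k] jk a0 b0.
  by move: b0; rewrite expr0 mulmx1 => ->; rewrite B0r mul0mx.
have E : B a b *m (D - (c + d)%:M) =
    B (a *m (D - c%:M)) b + B a (b *m (D - d%:M)).
  rewrite !mulmxBr der !mul_mx_scalar -!scaleN1r !BDl !BDr !BZl !BZr.
  by rewrite scalerDl scalerDr addrACA.
rewrite exprS -mulmxE mulmxA E mulmxDl.
have jkm : (j + k.+1)%N = m by case: jk.
rewrite (IHm _ _ jkm) ?add0r => //; last first.
  by move: a0; rewrite exprS -mulmxE mulmxA.
apply: (IHm j.+1 k) => //; first by rewrite addSnnS.
by move: b0; rewrite exprS -mulmxE mulmxA.
Qed.

End Derivation.

Lemma char_poly_conj (K : comUnitRingType) n (P D : 'M[K]_n) : P \in unitmx ->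
  char_poly (P *m D *m invmx P) = char_poly D.
Proof.
move=> uP; rewrite /char_poly.
have PV : map_mx polyC P *m map_mx polyC (invmx P) = 1%:M.
  by rewrite -map_mxM mulmxV // map_mx1.
have -> : char_poly_mx (P *m D *m invmx P)
    = map_mx polyC P *m char_poly_mx D *m map_mx polyC (invmx P).
  by rewrite mulmxBr mulmxBl scalar_mxC -(mulmxA _%:M) PV mulmx1 -!map_mxM.
by rewrite !det_mulmx mulrAC -det_mulmx PV det1 mul1r.
Qed.

Section ConjugatePart.
Variable C : numClosedFieldType.

Lemma trig_mulmx_diag n (U V : 'M[C]_n) : is_trig_mx U -> is_trig_mx V ->
  is_trig_mx (U *m V) /\ forall i, (U *m V) i i = U i i * V i i.
Proof.
move=> /is_trig_mxP tU /is_trig_mxP tV; split=> [|i].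
  apply/is_trig_mxP => i j ij; rewrite mxE big1 // => k _.
  have [ik | ki] := ltnP i k; first by rewrite tU ?mul0r.
  by rewrite tV ?mulr0 // (leq_ltn_trans ki).
rewrite mxE (bigD1 i) //= big1 ?addr0 // => k /eqP/val_eqP/= ki.
by case: ltngtP ki => // [ki|ik] _; [rewrite tV ?mulr0 | rewrite tU ?mul0r].
Qed.

Lemma horner_mx_trig n (U : 'M[C]_n.+1) p : is_trig_mx U ->
  is_trig_mx (horner_mx U p) /\ forall i, horner_mx U p i i = p.[U i i].
Proof.
move=> tU; elim/poly_ind: p => [|p c [tp pE]].
  by rewrite rmorph0; split=> [|i]; rewrite ?mx0_is_trig // mxE horner0.
rewrite rmorphD rmorphM /= horner_mx_X horner_mx_C -mulmxE.
have [tM ME] := trig_mulmx_diag tp tU; split=> [|i].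
  apply/is_trig_mxP => i j ij; rewrite mxE (is_trig_mxP tM) // mxE.
  by rewrite (_ : (i == j) = false) ?addr0 //; apply: ltn_eqF.
by rewrite mxE ME pE mxE eqxx hornerD hornerM hornerX hornerC.
Qed.

(** In Schur triangular form the trace is the sum of the squared moduli of the eigenvalues. If it
    vanishes they are all 0, and Cayley-Hamilton concludes. *)
Lemma nilp_of_trace n (D : 'M[C]_n.+1) (p : {poly C}) :
    (forall c, root (char_poly D) c -> p.[c] = c^*) ->
  \tr (D *m horner_mx D p) = 0 -> D ^+ n.+1 = 0.
Proof.
move=> pP; have [P /unitarymx_unit uP sDP] := Schur D (ltn0Sn n).
have tU : is_trig_mx (P *m D *m invmx P) by rewrite -conjumx.
set U := P *m D *m invmx P in tU.
have cE : char_poly D = char_poly U by rewrite char_poly_conj.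
have rU i : root (char_poly D) (U i i).
  rewrite cE char_poly_trig // /root horner_prod (bigD1 i) //=.
  by rewrite !hornerE subrr mul0r.
have -> : \tr (D *m horner_mx D p) = \sum_i `|U i i| ^+ 2.
  have [tp pE] := horner_mx_trig p tU.
  have [_ ME] := trig_mulmx_diag tU tp.
  transitivity (\tr (U *m horner_mx U p)).
    rewrite horner_mx_uconj // {1}/U [RHS]mxtrace_mulC !mulmxA.
    rewrite mulmxKV // mxtrace_mulC !mulmxA mulVmx // mul1mx.
    by rewrite mxtrace_mulC.
  by apply: eq_bigr => i _; rewrite ME pE pP // normCK.
move/eqP; rewrite psumr_eq0 => [/allP U0|i _]; last exact: exprn_ge0.
have := Cayley_Hamilton D; rewrite cE char_poly_trig //.
rewrite (eq_bigr (fun=> 'X)) => [|i _]; last first.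
  have /implyP/(_ isT) := U0 i (mem_index_enum _).
  by rewrite sqrf_eq0 normr_eq0 => /eqP->; rewrite subr0.
by rewrite prodr_const card_ord rmorphXn /= horner_mx_X.
Qed.

(* [T] acts as the scalar [c^*] on the generalized eigenspace of [D] for [c]. *)
Lemma conjugate_part n (D : 'M[C]_n) : exists T : 'M[C]_n,
  [/\ forall m (V : 'M_(m, n)), stablemx V D -> stablemx V T,
      forall B, (forall b, linear (B^~ b)) -> (forall a, linear (B a)) ->
        mx_derivation B D -> mx_derivation B T
    & \tr (D *m T) = 0 -> exists k, D ^+ k = 0].
Proof.
case: n D => [|n] D.
  exists 0; split=> [m V|B _ _ _ a b|_]; first by rewrite stablemx0.
    by apply/rowP => -[].
  by exists 0; apply/matrixP => -[].
have [s] := closed_field_poly_normal (char_poly D).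
rewrite (monicP (char_poly_monic D)) scale1r => sE.
pose e c := count_mem c s.
(* The sums [c + d] are included because [B a b] lies in the generalized eigenspace for [c + d],
   with exponent [e c + e d], at most twice [size s]. *)
have [p pP] := poly_interp Num.conj (size s + size s)
  (undup_uniq (s ++ [seq c + d | c <- s, d <- s])).
have {}pP c : c \in s ++ [seq c + d | c <- s, d <- s] ->
    ('X - c%:P) ^+ (size s + size s) %| p - (c^* )%:P.
  by rewrite -mem_undup => /pP.
have ind (P : 'rV[C]_n.+1 -> Prop) : P 0 -> (forall u v, P u -> P v -> P (u + v)) ->
    (forall c v, c \in s -> v *m (D - c%:M) ^+ e c = 0 -> P v) -> forall v, P v.
  move=> P0 PD Ps v; apply: (gen_eigen_ind (D := D) (e := e) P0 PD _ (undup_uniq s)).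
    by move=> c u; rewrite mem_undup; apply: Ps.
  have -> : \prod_(c <- undup s) ('X - c%:P) ^+ e c = char_poly D.
    by rewrite sE -[RHS]big_undup_iterop_count.
  by rewrite Cayley_Hamilton mulmx0.
have eM c : (e c <= size s + size s)%N.
  exact: leq_trans (count_size _ _) (leq_addr _ _).
exists (horner_mx D p); split.
- by move=> m V; apply: horner_mx_stable_gen.
- move=> B Bl Br der.
  pose BL b : {linear _ -> _} := HB.pack (B^~ b)
    (GRing.isLinear.Build _ _ _ _ (B^~ b) (Bl b)).
  pose BR a : {linear _ -> _} := HB.pack (B a)
    (GRing.isLinear.Build _ _ _ _ (B a) (Br a)).
  move=> a b; elim/ind: a => [|a a' IHa IHa'|c a cs ac].
  + by rewrite !mul0mx -![B 0 _]/(BL _ 0) !raddf0 mul0mx addr0.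
  + rewrite !mulmxDl -![B (_ + _) _]/(BL _ (_ + _)) !raddfD mulmxDl /=.
    by rewrite IHa IHa' addrACA.
  elim/ind: b => [|b b' IHb IHb'|d b ds bd].
  + by rewrite !mul0mx -![B _ 0]/(BR _ 0) !raddf0 mul0mx addr0.
  + rewrite !mulmxDl -![B _ (_ + _)]/(BR _ (_ + _)) !raddfD mulmxDl /=.
    by rewrite IHb IHb' addrACA.
  (* [T] scales [a], [b] and [B a b] by the conjugates of [c], [d] and [c + d], and conjugation is
     additive. *)
  have cdP := pP (c + d).
  rewrite (horner_mx_gen_eigen _ (derivation_gen_eigen Bl Br der ac bd) (cdP _)).
  + rewrite (horner_mx_gen_eigen (eM c) ac (pP _ _)) ?mem_cat ?cs //.
    rewrite (horner_mx_gen_eigen (eM d) bd (pP _ _)) ?mem_cat ?ds //.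
    by rewrite -[B (_ *: _) _]/(BL _ _) linearZ -[B _ (_ *: _)]/(BR _ _) linearZ /=
      -scalerDl rmorphD.
  + by rewrite leq_add ?count_size.
  + by rewrite mem_cat allpairs_f ?orbT.
- move=> tr0; exists n.+1; apply: nilp_of_trace tr0 => c.
  rewrite sE root_prod_XsubC => cs.
  (* The exponent in [pP] is positive because [s] contains [c]. *)
  have : root (p - (c^* )%:P) c.
    rewrite -dvdp_XsubCl; apply: dvdp_trans (pP c _); last by rewrite mem_cat cs.
    by rewrite dvdp_exp //; case: (s) cs.
  by rewrite /root !hornerE subr_eq0 => /eqP.
Qed.

End ConjugatePart.

(** * Ideals and the Jacobson radical *)

Section VspaceExtrema.
Variables (K : fieldType) (V : vectType K).
Implicit Types (P : {vspace V} -> Prop) (U W : {vspace V}).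

(** Induction on codimension: passing to strictly larger subspaces satisfying [P] must stop. *)
Lemma vspace_max P U : P U ->
  exists2 W, P W & forall W', P W' -> (W <= W')%VS -> W' = W.
Proof.
move: {2}(\dim _ - _)%N (leqnn (\dim {:V} - \dim U)) => k.
elim: k U => [|k IHk] U Uk PU.
  exists U => // W' _ UW; apply/esym/eqP; rewrite eqEdim UW /=.
  by rewrite (leq_trans (dimvS (subvf W'))) // -subn_eq0 -leqn0.
case: (pselect (exists2 W, P W & (U <= W)%VS && (W != U))) => [[W PW]|noW].
  case/andP=> UW nWU; apply: (IHk W) => //.
  have lt : (\dim U < \dim W)%N.
    by rewrite ltnNge; apply: contra nWU => le; rewrite eq_sym eqEdim UW.
  by lia.
exists U => // W' PW' UW'; apply/eqP; apply/negPn/negP => nW'.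
by apply: noW; exists W'; rewrite ?UW'.
Qed.

Lemma vspace_min P U : P U ->
  exists W, [/\ P W, (W <= U)%VS & forall W', P W' -> (W' <= W)%VS -> W' = W].
Proof.
move: {2}(\dim U) (leqnn (\dim U)) => k.
elim: k U => [|k IHk] U Uk PU.
  exists U; split=> // W' _ UW; apply/eqP; rewrite eqEdim UW /=.
  by move: Uk; rewrite leqn0 => /eqP->.
case: (pselect (exists2 W, P W & (W <= U)%VS && (W != U))) => [[W PW]|noW].
  case/andP=> WU nWU.
  have lt : (\dim W < \dim U)%N.
    by rewrite ltnNge; apply: contra nWU => le; rewrite eqEdim WU.
  have [|W1 [PW1 W1W mW1]] := IHk W _ PW; first by lia.
  by exists W1; split=> //; apply: subv_trans WU.
exists U; split=> // W' PW' UW'; apply/eqP; apply/negPn/negP => nW'.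
by apply: noW; exists W'; rewrite ?UW'.
Qed.

End VspaceExtrema.

Section LieBasics.
Variables (K : fieldType) (L : lieAlgType K).
Implicit Types (x y z : L) (I J M : {vspace L}).

HB.instance Definition _ x :=
  GRing.isLinear.Build K L L _ (lie x) (lie_linearr x).

(** The bracket with swapped arguments, so that linearity in the first argument can also be a
    canonical structure. *)
Definition liel y x : L := lie x y.

HB.instance Definition _ y :=
  GRing.isLinear.Build K L L _ (liel y) (lie_linearl y).

Lemma lieDr x y z : lie x (y + z) = lie x y + lie x z. Proof. exact: raddfD. Qed.
Lemma lieDl x y z : lie (x + y) z = lie x z + lie y z.
Proof. exact: (raddfD (liel z)). Qed.
Lemma lieZr a x y : lie x (a *: y) = a *: lie x y. Proof. exact: linearZ. Qed.
Lemma lieZl a x y : lie (a *: x) y = a *: lie x y.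
Proof. exact: (linearZZ (liel y)). Qed.
Lemma lie0r x : lie x 0 = 0. Proof. exact: raddf0. Qed.
Lemma lie0l x : lie 0 x = 0. Proof. exact: (raddf0 (liel x)). Qed.

Lemma lieC x y : lie x y = - lie y x.
Proof.
have := liexx (x + y); rewrite lieDl !lieDr !liexx add0r addr0.
by move/eqP; rewrite addr_eq0 => /eqP.
Qed.

(** The Jacobi identity in Leibniz form: [ad x] is a derivation. *)
Lemma lie_der x y z : lie x (lie y z) = lie (lie x y) z + lie y (lie x z).
Proof.
have := lie_jacobi x y z; rewrite [lie z x]lieC [lie z _]lieC raddfN /=.
by move/eqP; rewrite subr_eq0 subr_eq addrC => /eqP ->; rewrite addrC.
Qed.

Lemma lie_idealC I x y : lie_ideal I -> x \in I -> lie x y \in I.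
Proof. by move=> idI xI; rewrite lieC memvN idI. Qed.

Lemma lie_ideal_cap I J : lie_ideal I -> lie_ideal J -> lie_ideal (I :&: J).
Proof.
by move=> idI idJ x y; rewrite !memv_cap => /andP[yI yJ]; rewrite idI ?idJ.
Qed.

Lemma lie_ideal_add I J : lie_ideal I -> lie_ideal J -> lie_ideal (I + J).
Proof.
move=> idI idJ x _ /memv_addP[u uI [v vJ ->]].
by rewrite lieDr memv_add ?idI ?idJ.
Qed.

Lemma lie_idealf : lie_ideal (fullv : {vspace L}).
Proof. by move=> x y _; apply: memvf. Qed.

Definition minimal_lie_ideal I : Prop :=
  [/\ lie_ideal I, I <> 0%VS &
      forall J, lie_ideal J -> (J <= I)%VS -> J = 0%VS \/ J = I].

Lemma exists_minimal_lie_ideal I : lie_ideal I -> I <> 0%VS ->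
  exists2 J, minimal_lie_ideal J & (J <= I)%VS.
Proof.
move=> idI I0; have [J [[idJ J0] JI mJ]] :=
  vspace_min (P := fun J => lie_ideal J /\ J <> 0%VS) (conj idI I0).
exists J => //; split=> // J' idJ' J'J; have [->|/eqP J'0] := eqVneq J' 0%VS.
  by left.
by right; apply: mJ.
Qed.

Lemma jacobson_free_mem : jacobson_free L <->
  forall x, (forall M, maximal_lie_ideal M -> x \in M) -> x = 0.
Proof.
split=> [JF x xM|JF].
  suff : [set 0 : L]%classic x by [].
  by rewrite -JF => M /= /xM.
apply/seteqP; split=> [x xM|x /= -> M _]; last exact: mem0v.
by apply: JF => M /xM.
Qed.

(** A complement of a minimal ideal is maximal. If [x] is nonzero in the radical, take a minimal
    ideal [I1] inside the ideal generated by [x]: its complement contains [x], hence [I1], which is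
    absurd. *)
Lemma jacobson_free_of_complements :
    (forall I, minimal_lie_ideal I ->
       exists J, [/\ lie_ideal J, (I :&: J = 0)%VS & (I + J = fullv)%VS]) ->
  jacobson_free L.
Proof.
move=> compl; apply/jacobson_free_mem => x xM; apply/eqP/negPn/negP => x0.
have [I [[idI xI] _ mI]] :=
  vspace_min (P := fun I => lie_ideal I /\ x \in I) (conj lie_idealf (memvf x)).
have I0 : I <> 0%VS by move=> I0; move: xI; rewrite I0 memv0 (negPf x0).
have [I1 minI1 I1I] := exists_minimal_lie_ideal idI I0.
have [J [idJ capJ addJ]] := compl _ minI1; case: minI1 => idI1 I10 mI1.
suff maxJ : maximal_lie_ideal J.
  have : (I <= J)%VS.
    rewrite -(mI (I :&: J)%VS) ?capvSl ?capvSr //; split.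
      exact: lie_ideal_cap.
    by rewrite memv_cap xI xM.
  move/(subv_trans I1I)/capv_idPl; rewrite capJ => /esym; exact: I10.
split=> // [Jf|J' idJ' JJ']; first by apply: I10; rewrite -capJ Jf capvf.
(* By the modular law, [J'] is determined by its trace on [I1], which minimality restricts to 0 or
   [I1]. *)
have E : (I1 :&: J' + J = J')%VS.
  by rewrite addvC vspace_modl // addvC addJ capfv.
have [c0|cI] := mI1 (I1 :&: J')%VS (lie_ideal_cap idI1 idJ') (capvSl _ _).
  by left; rewrite -E c0 add0v.
by right; rewrite -E cI addJ.
Qed.

Lemma complement_of_jacobson_free I : jacobson_free L -> lie_ideal I ->
  exists J, [/\ lie_ideal J, (I :&: J = 0)%VS & (I + J = fullv)%VS].
Proof.
move=> /jacobson_free_mem JF idI.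
have [J [[idJ addJ] _ mJ]] :=
  vspace_min (P := fun J => lie_ideal J /\ (I + J = fullv)%VS)
    (conj lie_idealf (addvf I)).
exists J; split=> //; apply/eqP; rewrite -subv0; apply/subvP => x xIJ.
rewrite memv0; apply/eqP/JF => M [idM Mf mM]; apply/negPn/negP => xM.
have idIJ := lie_ideal_cap idI idJ.
have [MIJ|fullMIJ] := mM _ (lie_ideal_add idM idIJ) (addvSl _ _).
  by move: xM; rewrite -MIJ (subvP (addvSr _ _) _ xIJ).
(* Since [M + I :&: J] is everything, the modular law gives [I :&: J + J :&: M = J]; thus [J :&: M]
   still supplements [I], and minimality of [J] applies. *)
have JM : (J :&: M)%VS = J.
  apply: mJ (capvSl _ _); split; first exact: lie_ideal_cap.
  have -> : (I + J :&: M = I + (I :&: J + J :&: M))%VS.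
    by rewrite addvA (addv_idPl (capvSl _ _)).
  by rewrite addvC (addvC (I :&: J)%VS) vspace_modr ?capvSr // fullMIJ capvf addvC.
by move: xM; rewrite (subvP _ _ xIJ) // -JM (subv_trans (capvSr _ _)) ?capvSr.
Qed.

End LieBasics.

(** * Maximal ideals under surjective homomorphisms *)

Section Preimage.
Variables (K : fieldType) (L M : lieAlgType K) (g : {linear L -> M}).
Hypothesis gM : forall x y, g (lie x y) = lie (g x) (g y).
Hypothesis g_surj : forall u, exists x, g x = u.

(** Correspondence theorem: an ideal above the preimage contains the kernel of [g], so it is the
    preimage of its image, to which maximality of [I] applies. *)
Lemma maximal_lie_ideal_preim I : maximal_lie_ideal I ->
  maximal_lie_ideal (linfun g @^-1: I).
Proof.
case=> idI If mI; have mem x J : (x \in linfun g @^-1: J)%VS = (g x \in J).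
  by rewrite -memv_preim lfunE.
split=> [x y|pf|J idJ IJ]; first by rewrite !mem gM; apply: idI.
  apply: If; apply/eqP; rewrite eqEsubv subvf; apply/subvP => u _.
  by have [x <-] := g_surj u; rewrite -mem pf memvf.
have kJ x y : y \in J -> g x = g y -> x \in J.
  move=> yJ xy; rewrite -(subrK y x) memvD // (subvP IJ) // mem.
  by rewrite raddfB /= xy subrr mem0v.
have idgJ : lie_ideal (linfun g @: J)%VS.
  move=> u v /memv_imgP[y yJ ->]; have [x <-] := g_surj u.
  by rewrite lfunE -gM -[g _]lfunE memv_img ?idJ.
have IgJ : (I <= linfun g @: J)%VS.
  apply/subvP => u; have [x <-] := g_surj u => gI.
  by rewrite -[g _]lfunE memv_img // (subvP IJ) // mem.
have JE : J = (linfun g @^-1: (linfun g @: J))%VS.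
  apply/vspaceP => x; rewrite -memv_preim; apply/idP/idP => [/memv_img->//|].
  by case/memv_imgP=> y yJ; rewrite !lfunE => /kJ->.
have [E|E] := mI _ idgJ IgJ; [left | right]; rewrite JE E //.
by apply/vspaceP=> x; rewrite mem !memvf.
Qed.

(** Pulling maximal ideals back along [g] shows that the radical of [L] maps into that of [M]. *)
Lemma mem_max_surj x :
  (forall J : {vspace L}, maximal_lie_ideal J -> x \in J) ->
  jacobson_free M -> g x = 0.
Proof.
move=> xJ /jacobson_free_mem; apply=> I /maximal_lie_ideal_preim/xJ.
by rewrite -memv_preim lfunE.
Qed.

End Preimage.

(** * Engel's theorem *)

Section Engel.
Variables (K : fieldType) (L : lieAlgType K).
Implicit Types (x y : L) (U W G H : {vspace L}).

Definition lie_stable G U := forall x y, x \in G -> y \in U -> lie x y \in U.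

(* Relative to a pair [U <= W], so that the module [W / U] is never formed. *)
Definition engel_property G := forall U W, lie_stable G U -> lie_stable G W ->
  (U <= W)%VS -> U <> W ->
  exists w, [/\ w \in W, w \notin U & forall x, x \in G -> lie x w \in U].

(** Start from [w] sent into [U] by [H] and apply [ad y] up to the last iterate outside [U]. As [y]
    normalizes [H], every iterate is still sent into [U] by [H]. *)
Lemma engel_step H y : engel_property H -> lie_stable H H ->
  (forall x, x \in H -> lie x y \in H) -> (exists k, forall z, iter k (lie y) z = 0) ->
  engel_property (H + <[y]>).
Proof.
move=> EH HH Hy [k nil] U W stU stW UW nUW.
have sub : (H <= H + <[y]>)%VS by apply: addvSl.
have yG : y \in (H + <[y]>)%VS by rewrite (subvP (addvSr _ _)) ?memv_line.
have [||w [wW wU Hw]] := EH U W _ _ UW nUW.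
- by move=> x z xH; apply: stU; apply: (subvP sub).
- by move=> x z xH; apply: stW; apply: (subvP sub).
have ex : exists j, iter j (lie y) w \in U by exists k; rewrite nil mem0v.
(* [j.+1] is the first exponent landing in [U]; exponent 0 is excluded since [w] is outside [U]. *)
have [[|j] jU jmin] := ex_minnP ex; first by rewrite jU in wU.
have iW i : iter i (lie y) w \in W by elim: i => [//|i IHi] /=; apply: stW.
have iH i x : x \in H -> lie x (iter i (lie y) w) \in U.
  elim: i x => [|i IHi] x xH /=; first exact: Hw.
  by rewrite lie_der memvD ?IHi ?Hy // stU ?IHi.
exists (iter j (lie y) w); split=> //.
  by apply/negP => /jmin; rewrite ltnn.
move=> x /memv_addP[h hH [z /vlineP[a ->] ->]].
by rewrite lieDl lieZl memvD ?iH // memvZ.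
Qed.

(** Take [H] maximal among the subalgebras of [G] with the property. If [H] is proper, the property
    for the pair [H], [G] yields [y] outside [H] normalizing [H], and adjoining [y] contradicts
    maximality. *)
Lemma engel G : lie_stable G G ->
  (forall y, y \in G -> exists k, forall z, iter k (lie y) z = 0) ->
  engel_property G.
Proof.
move=> GG nil.
have [|H [HH HG EH] mH] := vspace_max (U := 0%VS)
  (P := fun H => [/\ lie_stable H H, (H <= G)%VS & engel_property H]).
  split; first by move=> x y; rewrite !memv0 => _ /eqP->; rewrite lie0r.
    exact: sub0v.
  move=> U W _ _ UW nUW; have : ~~ (W <= U)%VS.
    by apply/negP => WU; apply/nUW/eqP; rewrite eqEsubv UW.
  case/subvPn=> w wW wU; exists w; split=> // x.
  by rewrite memv0 => /eqP->; rewrite lie0l mem0v.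
have [<- //|/eqP nHG] := eqVneq H G.
have [|y [yG yH Hy]] := EH H G HH _ HG nHG.
  by move=> x y xH; apply: GG; apply: (subvP HG).
suff E : (H + <[y]>)%VS = H.
  by move: yH; rewrite -E (subvP (addvSr _ _)) ?memv_line.
apply: mH (addvSl _ _); split; last exact: engel_step (nil _ yG).
  move=> x z /memv_addP[h hH [_ /vlineP[a ->] ->]].
  move=> /memv_addP[h' hH' [_ /vlineP[b ->] ->]].
  rewrite (subvP (addvSl _ _)) // !(lieDl, lieDr, lieZl, lieZr) liexx !scaler0.
  have Hy' x' : x' \in H -> lie y x' \in H by move=> x'H; rewrite lieC memvN Hy.
  rewrite addr0; apply: memvD; last exact/memvZ/Hy'.
  by apply: memvD; [apply: HH | apply/memvZ/Hy].
by rewrite subv_add HG -memvE.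
Qed.

(** For [U] a maximal proper [G]-stable subspace of [G], Engel gives [w] outside [U] that [G] sends
    into [U]. Then [U + <[w]>] is stable, hence equals [G], so all brackets fall in [U]. *)
Lemma engel_not_perfect G : lie_stable G G -> G <> 0%VS ->
  (forall y, y \in G -> exists k, forall z, iter k (lie y) z = 0) ->
  exists U, [/\ (U <= G)%VS, U <> G & forall x y, x \in G -> y \in G -> lie x y \in U].
Proof.
move=> GG G0 nil.
have [|U [stU UG nUG] mU] := vspace_max (U := 0%VS)
  (P := fun U => [/\ lie_stable G U, (U <= G)%VS & U <> G]).
  split; [|exact: sub0v|by move/esym].
  by move=> x y; rewrite !memv0 => _ /eqP->; rewrite lie0r.
have [w [wG wU Gw]] := engel GG nil stU GG UG nUG.
have E : (U + <[w]>)%VS = G.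
  case: (pselect ((U + <[w]>)%VS = G)) => // nE.
  suff E : (U + <[w]>)%VS = U.
    by move: wU; rewrite -E (subvP (addvSr _ _)) ?memv_line.
  apply: mU (addvSl _ _); split=> //; last by rewrite subv_add UG -memvE.
  move=> x _ xG /memv_addP[u uU [_ /vlineP[a ->] ->]].
  rewrite (subvP (addvSl _ _)) // lieDr lieZr memvD ?memvZ ?Gw //.
  exact: stU.
exists U; split=> // x y xG; rewrite -{1}E.
move=> /memv_addP[u uU [_ /vlineP[a ->] ->]].
by rewrite lieDr lieZr memvD ?memvZ ?Gw ?stU.
Qed.

End Engel.

(** * Killing form *)

Section Killing.
Variables (K : fieldType) (L : lieAlgType K).
Implicit Types (x y z w : L) (I U : {vspace L}).

Definition ad_mx x : 'M[K]_(dim L) := lin1_mx (v2r \o lie x \o r2v).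

Lemma ad_mxE x w : v2r w *m ad_mx x = v2r (lie x w).
Proof. by rewrite mul_rV_lin1 /= v2rK. Qed.

Lemma eq_v2r_mulmx (A B : 'M[K]_(dim L)) :
  (forall w : L, v2r w *m A = v2r w *m B) -> A = B.
Proof. by move=> AB; apply/row_matrixP => i; rewrite !rowE -[delta_mx _ _]r2vK. Qed.

Lemma ad_mx_is_linear : linear ad_mx.
Proof.
move=> a x y; apply: eq_v2r_mulmx => w.
by rewrite mulmxDr -scalemxAr !ad_mxE lieDl lieZl linearP.
Qed.

HB.instance Definition _ :=
  GRing.isLinear.Build K L 'M[K]_(dim L) _ ad_mx ad_mx_is_linear.

(** The commutator is reversed because matrices act on row vectors from the right. *)
Lemma ad_mx_lie x y : ad_mx (lie x y) = ad_mx y *m ad_mx x - ad_mx x *m ad_mx y.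
Proof.
apply: eq_v2r_mulmx => w; rewrite mulmxBr !mulmxA !ad_mxE -raddfB /=; congr v2r.
by rewrite lie_der addrK.
Qed.

Lemma iter_lie_ad_mx x k w : v2r (iter k (lie x) w) = v2r w *m ad_mx x ^+ k.
Proof.
elim: k => [|k IHk] /=; first by rewrite expr0 mulmx1.
by rewrite exprSr -ad_mxE IHk mulmxA.
Qed.

Definition killing x y : K := \tr (ad_mx x *m ad_mx y).

Lemma killing_linearl y : linear_for *%R (killing^~ y).
Proof.
by move=> a x z; rewrite /killing linearP mulmxDl -scalemxAl raddfD /= mxtraceZ.
Qed.

Lemma killingC x y : killing x y = killing y x.
Proof. exact: mxtrace_mulC. Qed.

(** Invariance of the Killing form, from the cyclicity of the trace. *)
Lemma killing_lie x y z : killing (lie x y) z = - killing y (lie x z).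
Proof.
rewrite /killing !ad_mx_lie mulmxBl mulmxBr -(raddfN mxtrace) opprB /=.
rewrite !raddfB /= mulmxA.
by congr (_ - _); rewrite -mulmxA mxtrace_mulC mulmxA.
Qed.

(** Pairing with a basis of [I] only, so that the kernel has codimension at most [\dim I]. *)
Definition killing_row I x : 'rV[K]_(\dim I) :=
  \row_i killing x (vbasis I)`_i.

Lemma killing_row_is_linear I : linear (killing_row I).
Proof. by move=> a x y; apply/rowP => i; rewrite !mxE killing_linearl. Qed.

HB.instance Definition _ I :=
  GRing.isLinear.Build K L 'rV[K]_(\dim I) _ (killing_row I)
    (@killing_row_is_linear I).

Definition killing_perp I : {vspace L} := lker (linfun (killing_row I)).

Lemma killing_perpP I x :
  reflect (forall y, y \in I -> killing x y = 0) (x \in killing_perp I).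
Proof.
rewrite memv_ker lfunE /=; apply: (iffP eqP) => [xI y yI|xI]; last first.
  by apply/rowP => i; rewrite !mxE xI // vbasis_mem // mem_nth ?size_tuple.
have xb (i : 'I_(\dim I)) : killing (vbasis I)`_i x = 0.
  by have /rowP/(_ i) := xI; rewrite !mxE killingC.
rewrite killingC (coord_vbasis yI) /killing raddf_sum /= mulmx_suml raddf_sum /=.
apply: big1 => i _; rewrite linearZ /= -scalemxAl mxtraceZ.
by rewrite [\tr _]xb mulr0.
Qed.

Lemma lie_ideal_killing_perp I : lie_ideal I -> lie_ideal (killing_perp I).
Proof.
move=> idI x y /killing_perpP yI; apply/killing_perpP => z zI.
by rewrite killing_lie yI ?oppr0 ?idI.
Qed.

(** Rank-nullity bounds the dimension of the orthogonal below by the codimension of [I], so a direct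
    sum fills the space. *)
Lemma killing_perp_complement I : (I :&: killing_perp I = 0)%VS ->
  (I + killing_perp I = fullv)%VS.
Proof.
move=> cap0; apply/eqP; rewrite eqEdim subvf dimv_disjoint_sum //=.
rewrite -(limg_ker_dim (linfun (killing_row I)) fullv) capfv addnC leq_add2r.
by rewrite (leq_trans (dimvS (subvf _))) // dimvf /dim /= mul1n.
Qed.

Definition lie_derived I : {vspace L} :=
  <<[seq lie y z | y <- vbasis I, z <- vbasis I]>>%VS.

Lemma span_vbasis_subv I U : {subset vbasis I <= U} -> (I <= U)%VS.
Proof. by move=> IU; rewrite -(span_basis (vbasisP I)); apply/span_subvP. Qed.

Lemma memv_lie_derived I y z : y \in I -> z \in I -> lie y z \in lie_derived I.
Proof.
move=> yI zI; have sub y' : y' \in vbasis I -> lie y' z \in lie_derived I.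
  (* Membership becomes [z] lying in the preimage of a subspace, which is checked on the basis of
     [I]. *)
  move=> y'I; rewrite -[lie y' z](lfunE (lie y')) memv_preim.
  apply: (subvP (span_vbasis_subv _)) zI => z' z'I.
  by rewrite -memv_preim lfunE memv_span // allpairs_f.
rewrite -[lie y z](lfunE (liel z)) memv_preim.
apply: (subvP (span_vbasis_subv _)) yI => y' /sub.
by rewrite -memv_preim lfunE.
Qed.

Lemma lie_derived_subv I U :
  (forall y z, y \in I -> z \in I -> lie y z \in U) -> (lie_derived I <= U)%VS.
Proof.
move=> IU; apply/span_subvP => _ /allpairsP[[y z] /= [yI zI ->]].
by apply: IU; apply: vbasis_mem.
Qed.

Lemma lie_ideal_derived I : lie_ideal I -> lie_ideal (lie_derived I).
Proof.
move=> idI x w; suff : (lie_derived I <= linfun (lie x) @^-1: lie_derived I)%VS.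
  by move/subvP/(_ w) => H /H; rewrite -memv_preim lfunE.
apply: lie_derived_subv => y z yI zI; rewrite -memv_preim lfunE /= lie_der.
by rewrite memvD // memv_lie_derived // idI.
Qed.

End Killing.

(** * Cartan's argument and semisimple algebras *)

Section Cartan.
Variables (C : numClosedFieldType) (L : lieAlgType C).
Implicit Types (x y z w : L) (I U : {vspace L}).

(* The operator [T] that conjugates the eigenvalues of [ad x] is a derivation
   preserving [I], hence [tr (ad [y, z] T) = - killing y (T z) = 0] on [I]. *)
Lemma cartan_nilpotent I x : lie_ideal I -> (I <= lie_derived I)%VS ->
  (forall y z, y \in I -> z \in I -> killing y z = 0) -> x \in I ->
  exists k, forall w, iter k (lie x) w = 0.
Proof.
move=> idI II kI xI.
have [T [stT derT nilT]] := conjugate_part (ad_mx x).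
pose tau w : L := r2v (v2r w *m T).
have tauI w : w \in I -> tau w \in I.
  have memI u : (u \in I) = (v2r u <= vs2mx I)%MS by rewrite -genmxE.
  rewrite !memI r2vK => wI; apply: submx_trans (submxMr _ wI) (stT _ _ _).
  apply/row_subP => i; rewrite row_mul -[row i _]r2vK ad_mxE -memI.
  by apply: idI; rewrite memI r2vK row_sub.
have tau_der y z : tau (lie y z) = lie (tau y) z + lie y (tau z).
  pose B a b : 'rV[C]_(dim L) := v2r (lie (r2v a) (r2v b)).
  have : mx_derivation B T.
    apply: derT => [b a u v|a c u v|a b]; rewrite /B.
    - by rewrite linearP lieDl lieZl linearP.
    - by rewrite linearP lieDr lieZr linearP.
    rewrite ad_mxE lie_der raddfD /=; congr (v2r (lie _ _) + v2r (lie _ _)).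
      by rewrite -[a in RHS]r2vK ad_mxE v2rK.
    by rewrite -[b in RHS]r2vK ad_mxE v2rK.
  by move/(_ (v2r y) (v2r z)); rewrite /B !v2rK => H; rewrite /tau H raddfD /= !v2rK.
suff /nilT[k xk] : \tr (ad_mx x *m T) = 0.
  by exists k => w; apply: v2r_inj; rewrite iter_lie_ad_mx xk mulmx0 linear0.
pose phi w : C^o := \tr (ad_mx w *m T).
have phi_lin : linear phi.
  by move=> a u v; rewrite /phi linearP mulmxDl -scalemxAl raddfD /= mxtraceZ.
pose Phi : {linear L -> C^o} := HB.pack phi (GRing.isLinear.Build _ _ _ _ phi phi_lin).
(* As [x] is in [[I, I]], the linear form [Phi] need only vanish on brackets of elements of [I]. *)
suff /subvP/(_ x xI) : (I <= lker (linfun Phi))%VS by rewrite memv_ker lfunE => /eqP.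
apply: subv_trans II _; apply: lie_derived_subv => y z yI zI.
rewrite memv_ker lfunE /= /phi ad_mx_lie mulmxBl raddfB /=.
rewrite -[X in \tr X - _]mulmxA mxtrace_mulC -!mulmxA -raddfB -mulmxBr /=.
(* [tau] being a derivation, its commutator with [ad z] is [ad (tau z)]; the sign comes from the
   action on rows. *)
have -> : T *m ad_mx z - ad_mx z *m T = - ad_mx (tau z).
  apply: eq_v2r_mulmx => w; rewrite mulmxN mulmxBr !mulmxA !ad_mxE.
  rewrite -[v2r w *m T]r2vK -[v2r (lie z w) *m T]r2vK -/(tau _) -/(tau _).
  by rewrite ad_mxE tau_der raddfD /= opprD addrC subrK.
by rewrite mulmxN raddfN oppr_eq0; apply/eqP; apply: kI => //; apply: tauI.
Qed.

Lemma semisimple_complement I : lie_semisimple L -> minimal_lie_ideal I ->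
  exists J, [/\ lie_ideal J, (I :&: J = 0)%VS & (I + J = fullv)%VS].
Proof.
move=> ssL [idI I0 mI]; exists (killing_perp I).
have idP := lie_ideal_killing_perp idI.
suff cap0 : (I :&: killing_perp I = 0)%VS by split=> //; apply: killing_perp_complement.
have [//|/capv_idPl IP] := mI _ (lie_ideal_cap idI idP) (capvSl _ _); exfalso.
have DI : (lie_derived I <= I)%VS.
  by apply: lie_derived_subv => y z _; apply: idI.
have [D0|DE] := mI _ (lie_ideal_derived idI) DI.
  apply/I0/ssL; split=> // y z yI zI; apply/eqP.
  by rewrite -memv0 -D0 memv_lie_derived.
(* [I] is perfect and isotropic for the Killing form, so its elements are ad-nilpotent; Engel then
   gives a proper [U] containing [[I, I] = I]. *)
have [y yI|U [UI UnI IU]] := engel_not_perfect (fun y z _ => idI y z) I0.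
  apply: (cartan_nilpotent idI) yI; first by rewrite DE.
  by move=> u v uI; apply/killing_perpP/(subvP IP).
by apply/UnI/eqP; rewrite eqEsubv UI -{1}DE lie_derived_subv.
Qed.

Lemma jacobson_free_semisimple : lie_semisimple L -> jacobson_free L.
Proof.
by move=> ssL; apply: jacobson_free_of_complements => I; apply: semisimple_complement.
Qed.

End Cartan.

(** Every subspace is an ideal, so any linear complement serves. *)
Lemma jacobson_free_commutative (K : fieldType) (L : lieAlgType K) :
  lie_commutative L -> jacobson_free L.
Proof.
move=> cL; apply: jacobson_free_of_complements => I _; exists (I^C)%VS.
split; [by move=> x y; rewrite cL mem0v | exact: capv_compl | exact: addv_complf].
Qed.

(** * Decomposition along the center *)

Section IdealAlgebra.
Variables (K : fieldType) (L : lieAlgType K).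

(* The (irrelevant) ideal proof lets canonical structures find the bracket. *)
Definition ideal_alg (I : {vspace L}) of lie_ideal I : Type := subvs_of I.

Variables (I : {vspace L}) (idI : lie_ideal I).

HB.instance Definition _ := Vector.copy (ideal_alg idI) (subvs_of I).

Definition ideal_lie (u v : ideal_alg idI) : ideal_alg idI :=
  vsproj I (lie (vsval u) (vsval v)).

Lemma vsval_ideal_lie u v : vsval (ideal_lie u v) = lie (vsval u) (vsval v).
Proof. by rewrite vsprojK // idI // subvsP. Qed.

Fact ideal_lie_linearl v : linear (fun u => ideal_lie u v).
Proof.
move=> a u w; apply: subvs_inj.
by rewrite vsval_ideal_lie !linearP /= lieDl lieZl !vsval_ideal_lie.
Qed.

Fact ideal_lie_linearr u : linear (ideal_lie u).
Proof.
move=> a v w; apply: subvs_inj.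
by rewrite vsval_ideal_lie !linearP /= ?lieDr ?lieZr !vsval_ideal_lie.
Qed.

Fact ideal_liexx u : ideal_lie u u = 0.
Proof. by apply: subvs_inj; rewrite vsval_ideal_lie liexx linear0. Qed.

Fact ideal_lie_jacobi u v w : ideal_lie u (ideal_lie v w)
  + ideal_lie v (ideal_lie w u) + ideal_lie w (ideal_lie u v) = 0.
Proof.
by apply: subvs_inj; rewrite !raddfD /= !vsval_ideal_lie lie_jacobi.
Qed.

HB.instance Definition _ := Vector_isLieAlgebra.Build K (ideal_alg idI)
  ideal_lie_linearl ideal_lie_linearr ideal_liexx ideal_lie_jacobi.

End IdealAlgebra.

Section Decomposition.
Variables (K : fieldType) (L : lieAlgType K).

(** With values in ['End(L)], [ad] is a linear map between finite-dimensional spaces whose kernel is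
    the center. *)
Definition lie_lfun (x : L) : 'End(L) := linfun (lie x).

Fact lie_lfun_is_linear : linear lie_lfun.
Proof.
move=> a x y; apply/lfunP => z.
by rewrite add_lfunE scale_lfunE !lfunE /= lieDl lieZl.
Qed.

HB.instance Definition _ := GRing.isLinear.Build K L 'End(L) _
  lie_lfun lie_lfun_is_linear.

Definition lie_center : {vspace L} := lker (linfun lie_lfun).

Lemma lie_centerP x : reflect (forall y, lie x y = 0) (x \in lie_center).
Proof.
rewrite memv_ker lfunE /=; apply: (iffP eqP) => [x0 y | x0].
  by have /lfunP/(_ y) := x0; rewrite lfunE zero_lfunE.
by apply/lfunP => y; rewrite lfunE zero_lfunE /= x0.
Qed.

Lemma lie_ideal_center : lie_ideal lie_center.
Proof.
move=> x y /lie_centerP yZ; apply/lie_centerP => z.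
by rewrite (lieC x) yZ oppr0 lie0l.
Qed.

Lemma commutative_ideal_central I : jacobson_free L -> commutative_ideal I ->
  (I <= lie_center)%VS.
Proof.
move=> JF [idI cI]; have [J [idJ cap0 add1]] := complement_of_jacobson_free JF idI.
apply/subvP => x xI; apply/lie_centerP => y.
have : y \in (I + J)%VS by rewrite add1 memvf.
case/memv_addP=> u uI [v vJ ->]; rewrite lieDr cI // add0r; apply/eqP.
by rewrite -memv0 -cap0 memv_cap idJ // lie_idealC.
Qed.

Variables (S : {vspace L}) (idS : lie_ideal S).
Hypotheses (capS : (S :&: lie_center = 0)%VS) (addS : (S + lie_center = fullv)%VS).

Definition center_split (x : L) : ideal_alg idS * ideal_alg lie_ideal_center :=
  (vsproj S (daddv_pi S lie_center x), vsproj lie_center (daddv_pi lie_center S x)).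

Fact center_split_is_linear : linear center_split.
Proof. by move=> a x y; rewrite /center_split !linearP. Qed.

HB.instance Definition _ :=
  GRing.isLinear.Build K L (ideal_alg idS * ideal_alg lie_ideal_center)%type _
    center_split center_split_is_linear.

Lemma center_split_lie x y :
  center_split (lie x y) = lie (center_split x) (center_split y).
Proof.
set pS := daddv_pi S lie_center; set pZ := daddv_pi lie_center S.
have pE w : pS w + pZ w = w by rewrite daddv_pi_add // addS memvf.
have pSS w : pS w \in S by apply: memv_pi.
have pZc w u : lie (pZ w) u = 0 by apply/lie_centerP/memv_pi.
(* Central components drop out of brackets, so [lie x y] lies in [S] and its central projection is
   0. *)
have xyE : lie x y = lie (pS x) (pS y).
  rewrite -{1}(pE x) lieDl pZc addr0 -{1}(pE y) lieDr.
  by rewrite [lie _ (pZ y)]lieC pZc oppr0 addr0.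
have pSxy : pS (lie x y) = lie x y by rewrite daddv_pi_id // xyE idS.
have pZxy : pZ (lie x y) = 0.
  by have /eqP := pE (lie x y); rewrite pSxy -subr_eq0 addrC addKr => /eqP.
rewrite /center_split -/pS -/pZ pSxy pZxy; congr (_, _).
  by apply: subvs_inj; rewrite vsval_ideal_lie !vsprojK ?xyE ?idS.
apply: subvs_inj; rewrite vsval_ideal_lie linear0 linear0.
by rewrite vsprojK ?memv_pi // pZc.
Qed.

Lemma center_split_bij : bijective center_split.
Proof.
exists (fun uv : ideal_alg idS * ideal_alg lie_ideal_center =>
  vsval uv.1 + vsval uv.2) => [x|[u v]].
  by rewrite /= !vsprojK ?memv_pi // daddv_pi_add // addS memvf.
have uS := subvsP u; have vZ := subvsP v.
have pi0 U W w : (U :&: W = 0)%VS -> w \in W -> daddv_pi U W w = 0.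
  move=> UW0 wW; have /eqP := daddv_pi_add UW0 (subvP (addvSr U W) _ wW).
  by rewrite (daddv_pi_id (U := W)) 1?capvC // -subr_eq0 addrK => /eqP.
have capZ : (lie_center :&: S = 0)%VS by rewrite capvC.
rewrite /center_split /=.
have -> : daddv_pi S lie_center (vsval u + vsval v) = vsval u.
  by rewrite raddfD /= (pi0 _ _ _ _ _ capS vZ) addr0 daddv_pi_id.
have -> : daddv_pi lie_center S (vsval u + vsval v) = vsval v.
  by rewrite raddfD /= (pi0 _ _ _ _ _ capZ uS) add0r daddv_pi_id.
by rewrite !vsvalK.
Qed.

Lemma center_split_isomorphic :
  lie_isomorphic L (ideal_alg idS * ideal_alg lie_ideal_center)%type.
Proof.
by exists center_split; split; [apply: center_split_bij | apply: center_split_lie].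
Qed.

End Decomposition.

Lemma lie_commutative_center (K : fieldType) (L : lieAlgType K) :
  lie_commutative (ideal_alg (@lie_ideal_center K L)).
Proof.
move=> u v; apply: subvs_inj; rewrite vsval_ideal_lie linear0.
exact/lie_centerP/subvsP.
Qed.

Lemma lie_semisimple_center_complement (K : fieldType) (L : lieAlgType K)
    (S : {vspace L}) (idS : lie_ideal S) : jacobson_free L ->
  (S :&: lie_center L = 0)%VS -> (S + lie_center L = fullv)%VS ->
  lie_semisimple (ideal_alg idS).
Proof.
move=> JF cap0 add1 I [idI cI].
pose iota : {linear ideal_alg idS -> L} := @vsval K L S.
have mem x : x \in (linfun iota @: I)%VS -> exists2 u, u \in I & x = vsval u.
  by case/memv_imgP=> u uI ->; exists u => //; rewrite lfunE.
(* An ideal of [S] is an ideal of [L], since the other summand, the center, acts by zero. *)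
have comI : commutative_ideal (linfun iota @: I)%VS.
  split=> [x y /mem[u uI ->]|x y /mem[u uI ->] /mem[v vI ->]]; last first.
    by rewrite -vsval_ideal_lie [ideal_lie u v]cI ?linear0.
  have : x \in (S + lie_center L)%VS by rewrite add1 memvf.
  case/memv_addP=> s sS [z /lie_centerP zZ ->]; rewrite lieDl zZ addr0.
  have -> : lie s (vsval u) = linfun iota (lie (vsproj S s : ideal_alg idS) u).
    by rewrite lfunE [RHS]vsval_ideal_lie vsprojK.
  by rewrite memv_img ?idI.
apply/eqP; rewrite -subv0; apply/subvP => u uI; rewrite memv0; apply/eqP.
apply: subvs_inj; rewrite linear0; apply/eqP; rewrite -memv0 -cap0 memv_cap subvsP /=.
apply: (subvP (commutative_ideal_central JF comI)).
by rewrite -[vsval u]/(iota u) -lfunE memv_img.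
Qed.

Theorem corollary9p16 (R : realType) (L : lieAlgType R[i]) :
  jacobson_free L <->
  exists S A : lieAlgType R[i],
    lie_semisimple S /\ lie_commutative A /\ lie_isomorphic L (S * A)%type.
Proof.
split=> [JF | [S [A [ssS [cA [f [fbij fM]]]]]]].
  have [S [idS capS addS]] := complement_of_jacobson_free JF (@lie_ideal_center _ L).
  rewrite capvC in capS; rewrite addvC in addS.
  exists (ideal_alg idS), (ideal_alg (@lie_ideal_center _ L)).
  split; first exact: lie_semisimple_center_complement.
  by split; [apply: lie_commutative_center | apply: center_split_isomorphic].
have [g fK gK] := fbij; apply/jacobson_free_mem => x xM.
have f1M y z : (f (lie y z)).1 = lie (f y).1 (f z).1 by rewrite fM.
have f2M y z : (f (lie y z)).2 = lie (f y).2 (f z).2 by rewrite fM.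
pose f1 : {linear L -> S} := fst \o f; pose f2 : {linear L -> A} := snd \o f.
have fx1 : f1 x = 0.
  apply: mem_max_surj xM _ => [|u|]; first exact: f1M.
    by exists (g (u, 0)); rewrite /= gK.
  exact: jacobson_free_semisimple.
have fx2 : f2 x = 0.
  apply: mem_max_surj xM _ => [|u|]; first exact: f2M.
    by exists (g (0, u)); rewrite /= gK.
  exact: jacobson_free_commutative.
(* Both components of [f x] vanish, so [x = g (f x) = g 0 = g (f 0) = 0]. *)
by rewrite -[x]fK [f x]surjective_pairing [X in (X, _)]fx1 [X in (_, X)]fx2
  -[(0, 0)]/(0 : S * A) -[0](raddf0 f) fK.
Qed.
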